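(* Let $(\mathcal{C},\mathcal{N})$ be a homological category and let $$A\xrightarrow{f}B\xrightarrow{g}C,\qquad A'\xrightarrow{f'}B'\xrightarrow{g'}C',\qquad a\colon A\to A',\quad b\colon B\to B',\quad c\colon C\to C'$$ be morphisms in $\mathcal{C}$ with $bf=f'a$ and $cg=g'b$. Let $S$ be the left-hand commutative square (with sides $f,a,b,f'$) and $T$ the right-hand commutative square (with sides $g,b,c,g'$). Suppose that $b$ is an exact morphism and that the rows are exact (i.e. $A\to B\to C$ is exact at $B$ and $A'\to B'\to C'$ is exact at $B'$). Then the Lambek morphism $\Lambda\colon\mathrm{Im}\,S\to\mathrm{Ker}\,T$ is an isomorphism.
   Context: An ideal $\mathcal{N}$ in a category $\mathcal{C}$ is a class of morphisms such that for every $f\in\mathcal{N}$ every defined composite $hfg$ is in $\mathcal{N}$; morphisms in $\mathcal{N}$ are called null. The ideal is closed if there is a class $\mathcal{O}$ of objects such that $\mathcal{N}$ consists exactly of the morphisms factoring through some object of $\mathcal{O}$. A kernel of $f\colon A\to B$ (with respect to $\mathcal{N}$) is a morphism $k=\ker f\colon \mathrm{Ker}\,f\to A$ with $fk\in\mathcal{N}$ such that every $x$ with $fx\in\mathcal{N}$ factors as $x=kx'$ for a unique $x'$; cokernels $\mathrm{coker}\,f\colon B\to\mathrm{Coker}\,f$ are defined dually. A morphism is called a kernel (cokernel) if it is a kernel (cokernel) of some morphism. Equalities between kernels or cokernels are understood up to the canonical isomorphism. $(\mathcal{C},\mathcal{N})$ is semiexact if $\mathcal{N}$ is a closed ideal and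 every morphism has a kernel and a cokernel with respect to $\mathcal{N}$. It is homological if it is semiexact, kernels and cokernels are closed under composition, and: for every kernel $i\colon A\to B$ and cokernel $q\colon B\to C$ with $(\mathrm{coker}\,i)(\ker q)\in\mathcal{N}$ there exist a cokernel $\pi\colon A\to H$ and a kernel $\iota\colon H\to C$ with $qi=\iota\pi$. Put $\mathrm{im}\,f=\ker(\mathrm{coker}\,f)\colon\mathrm{Im}\,f\to B$ and $\mathrm{coim}\,f=\mathrm{coker}(\ker f)\colon A\to\mathrm{Coim}\,f$. Every morphism in a semiexact category factors as $f=(\mathrm{im}\,f)\,\overline{f}\,(\mathrm{coim}\,f)$ for a unique $\overline{f}\colon\mathrm{Coim}\,f\to\mathrm{Im}\,f$; $f$ is exact if $\overline f$ is an isomorphism. For the exact morphism $b$ one chooses representatives so that $\mathrm{Coim}\,b=\mathrm{Im}\,b$, $\overline b=\mathrm{id}$ and $b=(\mathrm{im}\,b)(\mathrm{coim}\,b)$. A sequence $X\xrightarrow{f}Y\xrightarrow{g}Z$ is exact at $Y$ if $\mathrm{im}\,f=\ker g$ (equivalently $\mathrm{coker}\,f=\mathrm{coim}\,g$). In a semiexact category, pullbacks of kernels along arbitrary morphisms and pushouts of cokernels along arbitrary morphisms exist. Lambek invariants. Let $Q$ be a commutative square with $u\colon X\to Y$ (top), $v\colon X\to Z$ (left), $w\colon Y\to W$ (right), $z\colon Z\to W$ (bottom), $wu=zv$. (1) Let $P$ be the pullback of $\mathrm{im}\,w\colon\mathrm{Im}\,w\to W$ and $\mathrm{im}\,z\colon\mathrm{Im}\,z\to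 W$, with projection $l_Q\colon P\to\mathrm{Im}\,w$. The morphisms $\overline w(\mathrm{coim}\,w)u\colon X\to\mathrm{Im}\,w$ and $\overline z(\mathrm{coim}\,z)v\colon X\to\mathrm{Im}\,z$ induce a unique $\lambda_Q\colon X\to P$ compatible with the projections. Put $\mathrm{Im}\,Q:=\mathrm{Coker}\,\lambda_Q$. (2) Let $N$ be the pushout of $\mathrm{coim}\,u\colon X\to\mathrm{Coim}\,u$ and $\mathrm{coim}\,v\colon X\to\mathrm{Coim}\,v$, with injection $r_Q\colon\mathrm{Coim}\,v\to N$. The morphisms $w(\mathrm{im}\,u)\overline u\colon\mathrm{Coim}\,u\to W$ and $z(\mathrm{im}\,v)\overline v\colon\mathrm{Coim}\,v\to W$ induce a unique $\rho_Q\colon N\to W$ compatible with the injections. Put $\mathrm{Ker}\,Q:=\mathrm{Ker}\,\rho_Q$. Lambek morphism. In the situation of two adjacent commutative squares $S$, $T$ as in the claim, with $b$ exact and $gf$, $g'f'$ null (which holds when the rows are exact), there is a unique morphism $\Lambda\colon\mathrm{Im}\,S\to\mathrm{Ker}\,T$ with $r_T\,l_S=(\ker\rho_T)\,\Lambda\,(\mathrm{coker}\,\lambda_S)$, where $r_Tl_S$ is formed using the identification $\mathrm{Coim}\,b=\mathrm{Im}\,b$; it is called the Lambek morphism of $S$ and $T$. *)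

(* Defs.v *)
(* No library beyond the Rocq prelude is used. *)

Set Implicit Arguments.
Unset Strict Implicit.

Record category := Category {
  Ob :> Type;
  Hom : Ob -> Ob -> Type;
  idm : forall A, Hom A A;
  comp : forall A B D, Hom B D -> Hom A B -> Hom A D;
  comp_assoc : forall A B D E (h : Hom D E) (g : Hom B D) (f : Hom A B),
    comp h (comp g f) = comp (comp h g) f;
  comp_idl : forall A B (f : Hom A B), comp (idm B) f = f;
  comp_idr : forall A B (f : Hom A B), comp f (idm A) = f
}.

Arguments Hom {c}.
Arguments idm {c}.

Declare Scope cat_scope.
Delimit Scope cat_scope with cat.
Notation "g ∘ f" := (comp g f) (at level 40, left associativity) : cat_scope.
Local Open Scope cat_scope.

Definition morphism_class (C : category) := forall A B : C, Hom A B -> Prop.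

Section Notions.

Context {C : category}.

Definition inverse {A B : C} (f : Hom A B) (g : Hom B A) : Prop :=
  g ∘ f = idm A /\ f ∘ g = idm B.

Definition is_iso {A B : C} (f : Hom A B) : Prop :=
  exists g : Hom B A, inverse f g.

Definition is_pullback {P X Y W : C} (p1 : Hom P X) (p2 : Hom P Y)
    (f : Hom X W) (g : Hom Y W) : Prop :=
  f ∘ p1 = g ∘ p2 /\
  forall (T : C) (x : Hom T X) (y : Hom T Y), f ∘ x = g ∘ y ->
    exists! t : Hom T P, p1 ∘ t = x /\ p2 ∘ t = y.

Definition is_pushout {X Y Z P : C} (f : Hom X Y) (g : Hom X Z)
    (i1 : Hom Y P) (i2 : Hom Z P) : Prop :=
  i1 ∘ f = i2 ∘ g /\
  forall (T : C) (y : Hom Y T) (z : Hom Z T), y ∘ f = z ∘ g ->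
    exists! t : Hom P T, t ∘ i1 = y /\ t ∘ i2 = z.

Variable N : morphism_class C.

Definition is_ideal : Prop :=
  forall (A B D E : C) (g : Hom A B) (f : Hom B D) (h : Hom D E),
    N f -> N (h ∘ f ∘ g).

Definition is_closed : Prop :=
  exists O : C -> Prop, forall (A B : C) (f : Hom A B),
    N f <-> exists (X : C) (s : Hom A X) (t : Hom X B), O X /\ f = t ∘ s.

Definition is_kernel {A B K : C} (f : Hom A B) (k : Hom K A) : Prop :=
  N (f ∘ k) /\
  forall (X : C) (x : Hom X A), N (f ∘ x) -> exists! x' : Hom X K, x = k ∘ x'.

Definition is_cokernel {A B Q : C} (f : Hom A B) (q : Hom B Q) : Prop :=
  N (q ∘ f) /\
  forall (X : C) (x : Hom B X), N (x ∘ f) -> exists! x' : Hom Q X, x = x' ∘ q.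

Definition a_kernel {K A : C} (k : Hom K A) : Prop :=
  exists (B : C) (f : Hom A B), is_kernel f k.

Definition a_cokernel {B Q : C} (q : Hom B Q) : Prop :=
  exists (A : C) (f : Hom A B), is_cokernel f q.

Definition semiexact : Prop :=
  is_ideal /\ is_closed /\
  (forall (A B : C) (f : Hom A B), exists (K : C) (k : Hom K A), is_kernel f k) /\
  (forall (A B : C) (f : Hom A B), exists (Q : C) (q : Hom B Q), is_cokernel f q).

Definition homological : Prop :=
  semiexact /\
  (forall (A B D : C) (k : Hom A B) (k' : Hom B D),
     a_kernel k -> a_kernel k' -> a_kernel (k' ∘ k)) /\
  (forall (A B D : C) (q : Hom A B) (q' : Hom B D),
     a_cokernel q -> a_cokernel q' -> a_cokernel (q' ∘ q)) /\
  (forall (A B D : C) (i : Hom A B) (q : Hom B D), a_kernel i -> a_cokernel q ->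
     forall (K E : C) (k : Hom K B) (p : Hom B E),
     is_kernel q k -> is_cokernel i p -> N (p ∘ k) ->
     exists (H : C) (pi : Hom A H) (iota : Hom H D),
       a_cokernel pi /\ a_kernel iota /\ q ∘ i = iota ∘ pi).

Definition is_image {A B I : C} (f : Hom A B) (m : Hom I B) : Prop :=
  exists (Q : C) (p : Hom B Q), is_cokernel f p /\ is_kernel p m.

Definition is_coimage {A B I : C} (f : Hom A B) (e : Hom A I) : Prop :=
  exists (K : C) (k : Hom K A), is_kernel f k /\ is_cokernel k e.

(* Kernels and cokernels are only determined up to isomorphism, so the
   invariants built from them are packaged together with the representatives
   used.  Here: im f, coim f and the morphism between them induced by f. *)
Record factorization {A B : C} (f : Hom A B) := Factorization {
  Coim : C;
  Im : C;
  coim : Hom A Coim;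
  bar : Hom Coim Im;
  im : Hom Im B;
  coimP : is_coimage f coim;
  imP : is_image f im;
  factorizationE : f = im ∘ bar ∘ coim
}.

Definition exact_morphism {A B : C} (f : Hom A B) : Prop :=
  exists F : factorization f, is_iso (bar F).

(* im f = ker g as subobjects of Y: they have a common representative. *)
Definition exact_at {X Y Z : C} (f : Hom X Y) (g : Hom Y Z) : Prop :=
  exists (I : C) (m : Hom I Y), is_image f m /\ is_kernel g m.

(* The invariants of a commutative square w ∘ u = z ∘ v

        X --u--> Y
        |v       |w
        Z --z--> W

   are Im Q = sqIm and Ker Q = sqKer. *)
Record square_image {X Y Z W : C} (u : Hom X Y) (v : Hom X Z)
    {w : Hom Y W} {z : Hom Z W} (Fw : factorization w) (Fz : factorization z) :=
SquareImage {
  sqP : C;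
  sq_l : Hom sqP (Im Fw);
  sq_l' : Hom sqP (Im Fz);
  sq_pullback : is_pullback sq_l sq_l' (im Fw) (im Fz);
  sq_lambda : Hom X sqP;
  sq_lambdaE : sq_l ∘ sq_lambda = bar Fw ∘ coim Fw ∘ u;
  sq_lambdaE' : sq_l' ∘ sq_lambda = bar Fz ∘ coim Fz ∘ v;
  sqIm : C;
  sq_coker : Hom sqP sqIm;
  sq_cokerP : is_cokernel sq_lambda sq_coker
}.

Record square_kernel {X Y Z W : C} {u : Hom X Y} {v : Hom X Z}
    (Fu : factorization u) (Fv : factorization v) (w : Hom Y W) (z : Hom Z W) :=
SquareKernel {
  sqN : C;
  sq_r' : Hom (Coim Fu) sqN;
  sq_r : Hom (Coim Fv) sqN;
  sq_pushout : is_pushout (coim Fu) (coim Fv) sq_r' sq_r;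
  sq_rho : Hom sqN W;
  sq_rhoE' : sq_rho ∘ sq_r' = w ∘ im Fu ∘ bar Fu;
  sq_rhoE : sq_rho ∘ sq_r = z ∘ im Fv ∘ bar Fv;
  sqKer : C;
  sq_ker : Hom sqKer sqN;
  sq_kerP : is_kernel sq_rho sq_ker
}.

(* For two adjacent squares sharing the side b, with b exact.  The
   identification of Im b with Coim b is the inverse of bar Fb; for
   representatives with bar Fb the identity, the equation is
   sq_r T ∘ sq_l S = sq_ker T ∘ L ∘ sq_coker S. *)
Definition is_lambek_morphism {A B D A' B' D' : C}
    {f : Hom A B} {g : Hom B D} {f' : Hom A' B'} {g' : Hom B' D'}
    {a : Hom A A'} {b : Hom B B'} {c : Hom D D'}
    {Fb : factorization b} {Ff' : factorization f'} {Fg : factorization g}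
    (S : square_image f a Fb Ff') (T : square_kernel Fg Fb c g')
    (L : Hom (sqIm S) (sqKer T)) : Prop :=
  exists binv : Hom (Im Fb) (Coim Fb),
    inverse (bar Fb) binv /\
    sq_r T ∘ binv ∘ sq_l S = sq_ker T ∘ L ∘ sq_coker S.

(* The representatives used above exist in a semiexact category. *)

Hypothesis HN : semiexact.

Lemma null_comp {A B D : C} (f : Hom A B) (h : Hom B D) : N f -> N (h ∘ f).
Proof.
intro Hf; destruct HN as [Hid _].
rewrite <- (comp_idr (h ∘ f)); now apply Hid.
Qed.

Lemma null_precomp {A B D : C} (g : Hom A B) (f : Hom B D) : N f -> N (f ∘ g).
Proof.
intro Hf; destruct HN as [Hid _].
rewrite <- (comp_idl (f ∘ g)), comp_assoc; now apply Hid.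
Qed.

Lemma kernel_mono {A B K X : C} (f : Hom A B) (k : Hom K A) (x y : Hom X K) :
  is_kernel f k -> k ∘ x = k ∘ y -> x = y.
Proof.
intros [Hn Hu] E.
destruct (Hu X (k ∘ x)) as [t [_ Ht]].
  rewrite comp_assoc; now apply null_precomp.
now rewrite <- (Ht x eq_refl), <- (Ht y E).
Qed.

Lemma cokernel_epi {A B Q X : C} (f : Hom A B) (q : Hom B Q) (x y : Hom Q X) :
  is_cokernel f q -> x ∘ q = y ∘ q -> x = y.
Proof.
intros [Hn Hu] E.
destruct (Hu X (x ∘ q)) as [t [_ Ht]].
  rewrite <- comp_assoc; now apply null_comp.
now rewrite <- (Ht x eq_refl), <- (Ht y E).
Qed.

Lemma cokernel_reflects_null {A B Q X : C} (f : Hom A B) (q : Hom B Q)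
    (h : Hom Q X) : is_cokernel f q -> N (h ∘ q) -> N h.
Proof.
intros Hq Hhq.
destruct (HN) as [_ [_ [_ HC]]].
destruct (HC _ _ (idm B)) as [Z [e He]].
assert (Ne : N e) by (rewrite <- (comp_idr e); apply He).
assert (N_id : N (idm Z)).
  destruct HN as [_ [[O HO] _]].
  destruct (proj1 (HO _ _ e) Ne) as [Y [s [t [HY E]]]].
  assert (Ns : N (s ∘ idm B)).
    apply HO; exists Y, s, (idm Y); rewrite comp_idl, comp_idr; now split.
  destruct (proj2 He _ s Ns) as [s' [Es _]].
  apply HO; exists Y, s', t; split; trivial.
  apply (cokernel_epi He); now rewrite comp_idl, <- comp_assoc, <- Es.
assert (Nhq : N (h ∘ q ∘ idm B)) by now rewrite comp_idr.
destruct (proj2 He _ _ Nhq) as [t [Et _]].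
destruct (proj2 Hq _ e (null_precomp f Ne)) as [e' [Ee _]].
replace h with (t ∘ idm Z ∘ e').
  now apply null_precomp, null_comp.
apply (cokernel_epi Hq); now rewrite comp_idr, Et, Ee, comp_assoc.
Qed.

Lemma factorization_exists {A B : C} (f : Hom A B) : inhabited (factorization f).
Proof.
destruct (HN) as [_ [_ [HK HC]]].
destruct (HC _ _ f) as [Q [p Hp]]; destruct (HK _ _ p) as [I [m Hm]].
destruct (HK _ _ f) as [K [k Hk]]; destruct (HC _ _ k) as [J [e He]].
destruct (proj2 He _ f (proj1 Hk)) as [h [Eh _]].
assert (Nph : N (p ∘ h)).
  apply (cokernel_reflects_null He).
  rewrite <- comp_assoc, <- Eh; apply Hp.
destruct (proj2 Hm _ h Nph) as [j [Ej _]].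
constructor; apply (@Factorization A B f J I e j m).
- now exists K, k.
- now exists Q, p.
- now rewrite <- Ej.
Qed.

Lemma square_image_exists {X Y Z W : C} (u : Hom X Y) (v : Hom X Z)
    (w : Hom Y W) (z : Hom Z W) (Fw : factorization w) (Fz : factorization z) :
  w ∘ u = z ∘ v -> inhabited (square_image u v Fw Fz).
Proof.
intro E.
destruct (HN) as [_ [_ [HK HC]]].
destruct (imP Fw) as [Q [p [_ Hm]]]; destruct (imP Fz) as [Q' [p' [_ Hm']]].
destruct (HK _ _ (p ∘ im Fz)) as [P [l' Hl']].
destruct (proj2 Hm _ (im Fz ∘ l')) as [l [El _]].
  rewrite comp_assoc; apply Hl'.
assert (PB : is_pullback l l' (im Fw) (im Fz)).
  split; [now symmetry|intros T x y Exy].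
  destruct (proj2 Hl' _ y) as [t [Et Ut]].
    rewrite <- comp_assoc, <- Exy, comp_assoc; now apply null_precomp, Hm.
  exists t; split.
    split; [|now symmetry].
    apply (kernel_mono Hm); now rewrite comp_assoc, <- El, Exy, Et, comp_assoc.
  intros t' [_ Et']; now apply Ut.
destruct (proj2 PB _ (bar Fw ∘ coim Fw ∘ u) (bar Fz ∘ coim Fz ∘ v))
  as [lam [[E1 E2] _]].
  rewrite !comp_assoc, <- !factorizationE; exact E.
destruct (HC _ _ lam) as [R [r Hr]].
constructor; exact (SquareImage PB E1 E2 Hr).
Qed.

Lemma square_kernel_exists {X Y Z W : C} (u : Hom X Y) (v : Hom X Z)
    (w : Hom Y W) (z : Hom Z W) (Fu : factorization u) (Fv : factorization v) :
  w ∘ u = z ∘ v -> inhabited (square_kernel Fu Fv w z).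
Proof.
intro E.
destruct (HN) as [_ [_ [HK HC]]].
destruct (coimP Fu) as [K [k [_ He]]]; destruct (coimP Fv) as [K' [k' [_ He']]].
destruct (HC _ _ (coim Fv ∘ k)) as [P [r Hr]].
destruct (proj2 He _ (r ∘ coim Fv)) as [r' [Er _]].
  rewrite <- comp_assoc; apply Hr.
assert (PO : is_pushout (coim Fu) (coim Fv) r' r).
  split; [now symmetry|intros T y x Exy].
  destruct (proj2 Hr _ x) as [t [Et Ut]].
    rewrite comp_assoc, <- Exy, <- comp_assoc; now apply null_comp, He.
  exists t; split.
    split; [|now symmetry].
    apply (cokernel_epi He).
    now rewrite <- comp_assoc, <- Er, Exy, Et, comp_assoc.
  intros t' [_ Et']; now apply Ut.
destruct (proj2 PO _ (w ∘ im Fu ∘ bar Fu) (z ∘ im Fv ∘ bar Fv))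
  as [rho [[E1 E2] _]].
  rewrite <- !(comp_assoc w), <- !(comp_assoc z), <- !factorizationE; exact E.
destruct (HK _ _ rho) as [R [m Hm]].
constructor; exact (SquareKernel PO E1 E2 Hm).
Qed.

End Notions.

Arguments is_lambek_morphism {C N A B D A' B' D' f g f' g' a b c Fb Ff' Fg} S T L.

(* Main.v *)
(* Write b = m e with e a cokernel and m a kernel, put I = Im b, φ = e f : A -> I
   and ψ = g' m : I -> D'.  Exactness of the rows makes l_S a kernel of ψ and
   r_T a cokernel of φ, while l_S λ_S = φ and ρ_T r_T = ψ.  The subquotient axiom
   factors r_T l_S as a kernel ι after a cokernel π.  Since kernels compose,
   l_S (im λ_S) is a kernel through which φ factors, so im φ = l_S (im λ_S),
   and π is a cokernel of λ_S; dually ι is a kernel of ρ_T. *)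

Require Import Defs.

Local Open Scope cat_scope.

(** * Duality *)

Definition op (C : category) : category :=
  @Category C (fun A B => Hom B A) (fun A => idm A)
    (fun A B D f g => g ∘ f)
    (fun A B D E h g f => eq_sym (comp_assoc f g h))
    (fun A B f => comp_idr f) (fun A B f => comp_idl f).

(* Kernels for [op_class N] are, up to conversion, cokernels for [N], and likewise
   for images, pullbacks and their duals: dual lemmas hold by instantiation. *)
Definition op_class {C : category} (N : morphism_class C) :
  morphism_class (op C) := fun A B => N B A.

Lemma op_semiexact {C : category} {N : morphism_class C} :
  semiexact N -> semiexact (op_class N).
Proof.
intros [Hid [[O HO] [HK HC]]]; split; [|split; [|split]].
- intros A B D E g f h Hf; cbn.
  (* In [C] the composite reads [g ∘ (f ∘ h)], so only its bracketing has to change. *)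
  unfold op_class; rewrite comp_assoc; now apply Hid.
- exists O; intros A B f; split.
  + intros Hf; destruct (proj1 (HO _ _ f) Hf) as [X [s [t H]]].
    now exists X, t, s.
  + intros [X [s [t H]]]; apply HO; now exists X, t, s.
- intros A B f; exact (HC _ _ f).
- intros A B f; exact (HK _ _ f).
Qed.

(** The subquotient axiom is self-dual: [i] and [q], [k] and [p], [pi] and [iota] trade places. *)
Lemma op_homological {C : category} {N : morphism_class C} :
  homological N -> homological (op_class N).
Proof.
intros [Hse [HK [HC Hsq]]]; split; [|split; [|split]].
- now apply op_semiexact.
- intros A B D k k' Hk Hk'; exact (HC _ _ _ k' k Hk' Hk).
- intros A B D q q' Hq Hq'; exact (HK _ _ _ q' q Hq' Hq).
- intros A B D i q Hi Hq K E k p Hk Hp Hpk.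
  destruct (Hsq _ _ _ q i Hq Hi _ _ p k Hp Hk Hpk)
    as [H [pi [iota [Hpi [Hiota Eq]]]]].
  now exists H, iota, pi.
Qed.

Lemma kernel_reflects_null {C : category} {N : morphism_class C}
    (HN : semiexact N) {A B K X : C} (f : Hom A B) (k : Hom K A) (h : Hom X K) :
  is_kernel N f k -> N _ _ (k ∘ h) -> N _ _ h.
Proof.
exact (cokernel_reflects_null (op_semiexact HN) (A := B : op C)
  (f := f) (q := k) (h := h)).
Qed.

(** * Independence of the chosen representatives *)

(** The definition of a kernel mentions [f] only through the class of [x] with [f ∘ x] null. *)
Lemma kernel_ext {C : category} {N : morphism_class C} {A B B' K : C}
    (f : Hom A B) (f' : Hom A B') (k : Hom K A) :
  (forall X (x : Hom X A), N _ _ (f ∘ x) <-> N _ _ (f' ∘ x)) ->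
  is_kernel N f k -> is_kernel N f' k.
Proof.
intros E [Hn Hu]; split; [now apply E|].
intros X x Hx; now apply Hu, E.
Qed.

Lemma cokernel_ext {C : category} {N : morphism_class C} {A A' B Q : C}
    (f : Hom A B) (f' : Hom A' B) (q : Hom B Q) :
  (forall X (x : Hom B X), N _ _ (x ∘ f) <-> N _ _ (x ∘ f')) ->
  is_cokernel N f q -> is_cokernel N f' q.
Proof. exact (kernel_ext (C := op C) (N := op_class N) f f' q). Qed.

Lemma kernel_unique {C : category} {N : morphism_class C} (HN : semiexact N)
    {A B K K' : C} (f : Hom A B) (k : Hom K A) (k' : Hom K' A) :
  is_kernel N f k -> is_kernel N f k' ->
  exists u : Hom K K', is_iso u /\ k = k' ∘ u.
Proof.
intros Hk Hk'.
destruct (proj2 Hk' _ k (proj1 Hk)) as [u [Eu _]].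
destruct (proj2 Hk _ k' (proj1 Hk')) as [v [Ev _]].
exists u; split; [exists v; split|exact Eu].
- apply (kernel_mono HN Hk); now rewrite comp_assoc, <- Ev, comp_idr.
- apply (kernel_mono HN Hk'); now rewrite comp_assoc, <- Eu, comp_idr.
Qed.

Lemma cokernel_unique {C : category} {N : morphism_class C} (HN : semiexact N)
    {A B Q Q' : C} (f : Hom A B) (q : Hom B Q) (q' : Hom B Q') :
  is_cokernel N f q -> is_cokernel N f q' ->
  exists u : Hom Q Q', is_iso u /\ q' = u ∘ q.
Proof.
intros Hq Hq'.
destruct (kernel_unique (op_semiexact HN) _ _ _ Hq' Hq) as [u [[v [E1 E2]] Eu]].
exists u; split; [now exists v|exact Eu].
Qed.

Lemma kernel_equiv {C : category} {N : morphism_class C} (HN : semiexact N)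
    {A B B' K : C} (f : Hom A B) (f' : Hom A B') (k : Hom K A) :
  is_kernel N f k -> is_kernel N f' k ->
  forall X (x : Hom X A), N _ _ (f ∘ x) -> N _ _ (f' ∘ x).
Proof.
intros Hk Hk' X x Hx.
destruct (proj2 Hk _ x Hx) as [t [-> _]].
rewrite comp_assoc; now apply (null_precomp HN), Hk'.
Qed.

(** Two cokernels of [f] differ by an isomorphism, which does not affect nullness of composites. *)
Lemma image_kernel {C : category} {N : morphism_class C} (HN : semiexact N)
    {A B Q I : C} (f : Hom A B) (m : Hom I B) (p : Hom B Q) :
  is_image N f m -> is_cokernel N f p -> is_kernel N p m.
Proof.
intros [Q' [p' [Hp' Hm]]] Hp.
destruct (cokernel_unique HN _ _ _ Hp' Hp) as [u [[v [E _]] ->]].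
apply (kernel_ext p'); trivial; intros X x; split; intro Hx.
- rewrite <- comp_assoc; now apply (null_comp HN).
- rewrite <- (comp_idl (p' ∘ x)), <- E, <- comp_assoc, (comp_assoc u).
  now apply (null_comp HN).
Qed.

Lemma coimage_cokernel {C : category} {N : morphism_class C} (HN : semiexact N)
    {A B K I : C} (f : Hom A B) (e : Hom A I) (k : Hom K A) :
  is_coimage N f e -> is_kernel N f k -> is_cokernel N k e.
Proof. exact (image_kernel (op_semiexact HN) (A := B : op C) f e k). Qed.

Lemma exact_at_image {C : category} {N : morphism_class C} (HN : semiexact N)
    {X Y Z I : C} (f : Hom X Y) (g : Hom Y Z) (m : Hom I Y) :
  exact_at N f g -> is_image N f m -> is_kernel N g m.
Proof.
intros [I0 [m0 [Hm0 Hg]]] [Q [p [Hp Hm]]].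
assert (Hm0p := image_kernel HN _ _ _ Hm0 Hp).
apply (kernel_ext p); trivial; intros T x; split.
- exact (kernel_equiv HN _ _ _ Hm0p Hg T x).
- exact (kernel_equiv HN _ _ _ Hg Hm0p T x).
Qed.

(** With [m0] a common representative of im f and ker g, the same morphisms annihilate [f] and [m0]:
    [f] factors through [m0], and whatever annihilates [f] factors through coker f, which
    annihilates [m0]. *)
Lemma exact_at_coimage {C : category} {N : morphism_class C} (HN : semiexact N)
    {X Y Z I : C} (f : Hom X Y) (g : Hom Y Z) (e : Hom Y I) :
  exact_at N f g -> is_coimage N g e -> is_cokernel N f e.
Proof.
intros [I0 [m0 [[Q [p [Hp Hm0]]] Hg]]] He.
apply (cokernel_ext m0); [|exact (coimage_cokernel HN _ _ _ He Hg)].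
intros T x; split; intro Hx.
- destruct (proj2 Hm0 _ f (proj1 Hp)) as [t [-> _]].
  rewrite comp_assoc; now apply (null_precomp HN).
- destruct (proj2 Hp _ x Hx) as [t [-> _]].
  rewrite <- comp_assoc; apply (null_comp HN), Hm0.
Qed.

(** Exactness provides one good factorization [G]; any other has the same [bar] up to isomorphisms
    on both sides. *)
Lemma exact_bar_iso {C : category} {N : morphism_class C} (HN : semiexact N)
    {A B : C} (f : Hom A B) (F : factorization N f) :
  exact_morphism N f -> is_iso (bar F).
Proof.
intros [G [w [Ew Ew']]].
destruct (coimP G) as [K [k [Hk He]]]; destruct (imP G) as [Q [p [Hp Hm]]].
assert (He' := coimage_cokernel HN _ _ _ (coimP F) Hk).
assert (Hm' := image_kernel HN _ _ _ (imP F) Hp).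
destruct (cokernel_unique HN _ _ _ He He') as [u [[u' [Eu Eu']] Ecoim]].
destruct (kernel_unique HN _ _ _ Hm Hm') as [v [[v' [Ev Ev']] Eim]].
assert (E : bar F = v ∘ bar G ∘ u').
  apply (kernel_mono HN Hm'), (cokernel_epi HN He').
  rewrite <- factorizationE, !comp_assoc, <- Eim, Ecoim.
  rewrite <- (comp_assoc _ u'), (comp_assoc u' u), Eu, comp_idl.
  apply factorizationE.
exists (u ∘ w ∘ v'); rewrite E; split.
- rewrite !comp_assoc, <- (comp_assoc _ v' v), Ev, comp_idr.
  now rewrite <- (comp_assoc _ w), Ew, comp_idr.
- rewrite !comp_assoc, <- (comp_assoc _ u' u), Eu, comp_idr.
  now rewrite <- (comp_assoc _ (bar G)), Ew', comp_idr.
Qed.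

(** * Pullbacks of kernels and pushouts of cokernels *)

Lemma kernel_pullback {C : category} {N : morphism_class C} (HN : semiexact N)
    {P X Y W Z : C} (p1 : Hom P X) (p2 : Hom P Y) (m : Hom X W) (n : Hom Y W)
    (g : Hom W Z) :
  is_pullback p1 p2 m n -> is_kernel N g n -> is_kernel N (g ∘ m) p1.
Proof.
intros [E Hu] [Hn Hk]; split.
- rewrite <- comp_assoc, E, comp_assoc; now apply (null_precomp HN).
- intros T x Hx.
  destruct (Hk _ (m ∘ x)) as [y [Ey Uy]]; [now rewrite comp_assoc|].
  destruct (Hu _ x y Ey) as [t [[Et _] Ut]].
  exists t; split; [easy|].
  intros t' Et'; apply Ut; split; [easy|].
  symmetry; apply Uy; now rewrite Et', !comp_assoc, E.
Qed.

Lemma cokernel_pushout {C : category} {N : morphism_class C} (HN : semiexact N)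
    {X Y Z P W : C} (e : Hom X Y) (q : Hom X Z) (i1 : Hom Y P) (i2 : Hom Z P)
    (f : Hom W X) :
  is_pushout e q i1 i2 -> is_cokernel N f q -> is_cokernel N (e ∘ f) i1.
Proof. exact (kernel_pullback (op_semiexact HN) (P := P : op C) i1 i2 e q f). Qed.

Lemma pushout_sym {C : category} {X Y Z P : C} (f : Hom X Y) (g : Hom X Z)
    (i1 : Hom Y P) (i2 : Hom Z P) :
  is_pushout f g i1 i2 -> is_pushout g f i2 i1.
Proof.
intros [E Hu]; split; [easy|].
intros T y z Eyz; destruct (Hu T z y (eq_sym Eyz)) as [t [[E1 E2] Ut]].
exists t; split; [easy|]; intros t' [E1' E2']; now apply Ut.
Qed.

Lemma cokernel_iso {C : category} {N : morphism_class C} {A B B' Q : C}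
    (f : Hom A B) (q : Hom B Q) (u : Hom B B') (v : Hom B' B) :
  inverse u v -> is_cokernel N f q -> is_cokernel N (u ∘ f) (q ∘ v).
Proof.
intros [E1 E2] [Hn Hu]; split.
- now rewrite !comp_assoc, <- (comp_assoc q), E1, comp_idr.
- intros X x Hx.
  destruct (Hu X (x ∘ u)) as [t [Et Ut]]; [now rewrite <- comp_assoc|].
  exists t; split.
  + now rewrite comp_assoc, <- Et, <- comp_assoc, E2, comp_idr.
  + intros t' ->; apply Ut.
    now rewrite comp_assoc, <- (comp_assoc (t' ∘ q)), E1, comp_idr.
Qed.

(** * The subquotient axiom and the Lambek morphism *)

Lemma cokernel_of_lift {C : category} {N : morphism_class C}
    (HN : homological N) {A P I R H : C} (lam : Hom A P) (l : Hom P I)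
    (r : Hom I R) (pi : Hom P H) (iota : Hom H R) :
  a_kernel N l -> is_cokernel N (l ∘ lam) r ->
  a_cokernel N pi -> a_kernel N iota -> r ∘ l = iota ∘ pi ->
  is_cokernel N lam pi.
Proof.
intros Hl Hr [Z [h Hpi]] [V [w Hiota]] E.
assert (Hse := proj1 HN); destruct (Hse) as [_ [_ [HK HC]]].
destruct (HC _ _ lam) as [Q [p Hp]]; destruct (HK _ _ p) as [J [j Hj]].
assert (Hlj : a_kernel N (l ∘ j)).
  apply (proj1 (proj2 HN)); trivial; now exists Q, p.
destruct Hlj as [Y [k Hk]]; destruct Hl as [U [s Hl]].
(* [l ∘ j] is a kernel through which [l ∘ lam] factors, so it contains
   im (l ∘ lam). *)
assert (Hkr : exists k', k = k' ∘ r).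
  destruct (proj2 Hj _ lam (proj1 Hp)) as [lam' [Elam _]].
  destruct (proj2 Hr _ k) as [k' [Ek' _]]; [|now exists k'].
  rewrite Elam, !comp_assoc; rewrite <- (comp_assoc k).
  apply (null_precomp Hse), Hk.
destruct Hkr as [k' Ek'].
(* As [r ∘ l ∘ h = iota ∘ pi ∘ h] is null, [k] annihilates [l ∘ h], which therefore factors through
   [l ∘ j]; the kernel [l] cancels. *)
assert (Hh : exists t, h = j ∘ t).
  destruct (proj2 Hk _ (l ∘ h)) as [t [Et _]].
    rewrite Ek', <- comp_assoc, (comp_assoc r), E, <- (comp_assoc iota).
    apply (null_comp Hse), (null_comp Hse), Hpi.
  exists t; apply (kernel_mono Hse Hl); now rewrite comp_assoc.
destruct Hh as [t Et].
(* Since [pi] is a cokernel of [h], it suffices that [h] and [lam] are annihilated by the same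
   morphisms. *)
apply (cokernel_ext h); trivial; intros X x; split; intro Hx.
- destruct (proj2 Hpi _ x Hx) as [y [-> _]].
  rewrite <- comp_assoc; apply (null_comp Hse).
  apply (kernel_reflects_null Hse _ _ _ Hiota).
  rewrite comp_assoc, <- E, <- comp_assoc; apply Hr.
- destruct (proj2 Hp _ x Hx) as [y [-> _]].
  rewrite Et, comp_assoc, <- (comp_assoc y).
  apply (null_precomp Hse), (null_comp Hse), Hj.
Qed.

(** Dual to [cokernel_of_lift], with [rho], [r], [l] in the roles of [lam], [l], [r], and [pi],
    [iota] exchanged. *)
Lemma kernel_of_extension {C : category} {N : morphism_class C}
    (HN : homological N) {P I R E H : C} (rho : Hom R E) (r : Hom I R)
    (l : Hom P I) (pi : Hom P H) (iota : Hom H R) :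
  a_cokernel N r -> is_kernel N (rho ∘ r) l ->
  a_cokernel N pi -> a_kernel N iota -> r ∘ l = iota ∘ pi ->
  is_kernel N rho iota.
Proof.
intros Hr Hl Hpi Hiota Eq.
exact (cokernel_of_lift (op_homological HN) (A := E : op C)
  rho r l iota pi Hr Hl Hiota Hpi Eq).
Qed.

Lemma subquotient_factorization {C : category} {N : morphism_class C}
    (HN : homological N) {A P I R E : C} (lam : Hom A P) (l : Hom P I)
    (r : Hom I R) (rho : Hom R E) :
  is_kernel N (rho ∘ r) l -> is_cokernel N (l ∘ lam) r ->
  exists (H : C) (pi : Hom P H) (iota : Hom H R),
    is_cokernel N lam pi /\ is_kernel N rho iota /\ r ∘ l = iota ∘ pi.
Proof.
intros Hl Hr.
assert (Hse := proj1 HN); destruct (Hse) as [_ [_ [HK HC]]].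
assert (Kl : a_kernel N l) by now exists E, (rho ∘ r).
assert (Cr : a_cokernel N r) by now exists A, (l ∘ lam).
destruct (HK _ _ r) as [K [k Hk]]; destruct (HC _ _ l) as [Q [p Hp]].
(* The premise of the subquotient axiom: [p] annihilates [l ∘ lam], hence factors through its
   cokernel [r], and [r ∘ k] is null. *)
assert (Hpk : N _ _ (p ∘ k)).
  destruct (proj2 Hr _ p) as [p' [-> _]].
    rewrite comp_assoc; apply (null_precomp Hse), Hp.
  rewrite <- comp_assoc; apply (null_comp Hse), Hk.
destruct (proj2 (proj2 (proj2 HN)) _ _ _ l r Kl Cr _ _ k p Hk Hp Hpk)
  as [H [pi [iota [Hpi [Hiota Eq]]]]].
exists H, pi, iota; split; [|split; trivial].
- exact (cokernel_of_lift HN _ _ _ _ _ Kl Hr Hpi Hiota Eq).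
- exact (kernel_of_extension HN _ _ _ _ _ Cr Hl Hpi Hiota Eq).
Qed.

Theorem theorem2 (C : category) (N : morphism_class C) (HN : homological N)
  (A B D A' B' D' : C)
  (f : Hom A B) (g : Hom B D) (f' : Hom A' B') (g' : Hom B' D')
  (a : Hom A A') (b : Hom B B') (c : Hom D D')
  (commS : b ∘ f = f' ∘ a) (commT : c ∘ g = g' ∘ b)
  (exact_b : exact_morphism N b)
  (exact_fg : exact_at N f g) (exact_f'g' : exact_at N f' g')
  (Fb : factorization N b) (Ff' : factorization N f') (Fg : factorization N g)
  (S : square_image f a Fb Ff') (T : square_kernel Fg Fb c g') :
  exists Lambda : Hom (sqIm S) (sqKer T),
    unique (is_lambek_morphism S T) Lambda /\ is_iso Lambda.
Proof.
assert (Hse := proj1 HN).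
destruct (exact_bar_iso Hse b Fb exact_b) as [w Hw].
(* The composite with [sq_rho T] is [g' ∘ im Fb], and [sq_l S] is the pullback along [im Fb] of im
   f', a kernel of [g']. *)
assert (Hl : is_kernel N (sq_rho T ∘ (sq_r T ∘ w)) (sq_l S)).
  rewrite comp_assoc, sq_rhoE, <- (comp_assoc _ (bar Fb)), (proj2 Hw), comp_idr.
  apply (kernel_pullback Hse _ _ _ _ _ (sq_pullback S)).
  exact (exact_at_image Hse _ _ _ exact_f'g' (imP Ff')).
(* Dually, [sq_r T] is the pushout along [coim Fb] of coim g, a cokernel of [f]; the isomorphism
   [bar Fb] moves it from Coim b to Im b. *)
assert (Hr : is_cokernel N (sq_l S ∘ sq_lambda S) (sq_r T ∘ w)).
  rewrite sq_lambdaE, <- comp_assoc; apply (cokernel_iso _ _ _ _ Hw).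
  apply (cokernel_pushout Hse _ _ _ _ _ (pushout_sym _ _ _ _ (sq_pushout T))).
  exact (exact_at_coimage Hse _ _ _ exact_fg (coimP Fg)).
destruct (subquotient_factorization HN _ _ _ _ Hl Hr)
  as [H [pi [iota [Hpi [Hiota E]]]]].
(* [pi] and [iota] are other representatives of [sq_coker S] and [sq_ker T]; the comparison
   isomorphisms compose to the Lambek morphism [v ∘ u]. *)
destruct (cokernel_unique Hse _ _ _ (sq_cokerP S) Hpi) as [u [[u' [Eu Eu']] Epi]].
destruct (kernel_unique Hse _ _ _ Hiota (sq_kerP T)) as [v [[v' [Ev Ev']] Eiota]].
assert (EL : sq_r T ∘ w ∘ sq_l S = sq_ker T ∘ (v ∘ u) ∘ sq_coker S).
  now rewrite E, Epi, Eiota, !comp_assoc.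
exists (v ∘ u); split; [split|].
- now exists w.
- intros L [w' [Hw' EL']].
  (* Being a Lambek morphism only asserts some inverse of [bar Fb]; inverses are unique, so both
     equations use the same one. *)
  assert (Ew : w' = w).
    now rewrite <- (comp_idr w'), <- (proj2 Hw), comp_assoc, (proj1 Hw'), comp_idl.
  subst w'; rewrite EL in EL'.
  apply (kernel_mono Hse (sq_kerP T)), (cokernel_epi Hse (sq_cokerP S)).
  exact EL'.
- exists (u' ∘ v'); split.
  + now rewrite comp_assoc, <- (comp_assoc u'), Ev, comp_idr.
  + now rewrite comp_assoc, <- (comp_assoc v), Eu', comp_idr.
Qed.
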